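(* Let $n\ge 4$ be even and let $a_1,\dots,a_n$ be positive real numbers, with indices read modulo $n$. The following are equivalent. (i) There exists a convex $n$-gon circumscribed about a circle whose side lengths, in cyclic order, are $a_1,\dots,a_n$. (ii) There exist positive real numbers $t_1,\dots,t_n$ with $a_j=t_j+t_{j+1}$ for $j=1,\dots,n-1$ and $a_n=t_n+t_1$. (iii) $a_1-a_2+a_3-\cdots+a_{n-1}-a_n=0$ and $$\min\left(a_1,\;a_1-a_2+a_3,\;\dots,\;a_1-a_2+\cdots-a_{n-2}+a_{n-1}\right)>\max\left(0,\;a_1-a_2,\;a_1-a_2+a_3-a_4,\;\dots,\;a_1-a_2+\cdots+a_{n-3}-a_{n-2}\right).$$ (iv) $a_1-a_2+a_3-\cdots+a_{n-1}-a_n=0$ and for every $j\in\{1,\dots,n\}$ and every odd $\ell$ with $1\le\ell\le n-1$, $$\sum_{m=0}^{\ell-1}(-1)^m a_{j+m}>0.$$ (v) $a_1-a_2+a_3-\cdots+a_{n-1}-a_n=0$ and the $n^2/4$ inequalities $$\sum_{m=0}^{\ell-1}(-1)^m a_{j+m}>0$$ hold for every odd $j\in\{1,\dots,n\}$ and every odd $\ell$ with $1\le\ell\le n-1$.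
   Context: A convex $n$-gon is circumscribed about a circle if it encloses the circle and each of its $n$ sides is tangent to the circle. ''Side lengths $a_1,\dots,a_n$ in cyclic order'' means that the vertices can be labelled consecutively $P_1,\dots,P_n$ (indices modulo $n$) so that $|P_jP_{j+1}|=a_j$ for all $j$. *)

(* Defs.v *)
From HB Require Import structures.
From mathcomp Require Import all_boot all_order all_algebra.
From mathcomp Require Import all_classical all_reals.
Set Implicit Arguments.
Unset Strict Implicit.
Unset Printing Implicit Defensive.
Import Order.TTheory GRing.Theory Num.Theory.
Local Open Scope classical_set_scope.
Local Open Scope ring_scope.

(* The Euclidean plane is 'rV[R]_2. The norm that matrices carry in          *)
(* MathComp-Analysis is the sup norm, hence the explicit Euclidean distance. *)
Definition edist (R : realType) (A B : 'rV[R]_2) : R :=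
  Num.sqrt (\sum_(i < 2) (B 0 i - A 0 i) ^+ 2).

Definition line (R : realType) (A B : 'rV[R]_2) : set 'rV[R]_2 :=
  [set X | exists s : R, X = (1 - s) *: A + s *: B].

Definition segment (R : realType) (A B : 'rV[R]_2) : set 'rV[R]_2 :=
  [set X | exists s : R, 0 <= s <= 1 /\ X = (1 - s) *: A + s *: B].

Definition circle (R : realType) (c : 'rV[R]_2) (r : R) : set 'rV[R]_2 :=
  [set X | edist c X = r].

Definition convex_hull (R : realType) (n : nat) (P : 'I_n -> 'rV[R]_2) :
    set 'rV[R]_2 :=
  [set X | exists w : 'I_n -> R,
     [/\ forall i, 0 <= w i, \sum_i w i = 1 & X = \sum_i w i *: P i]].

(* Twice the signed area of the triangle ABC: its sign tells on which side   *)
(* of the line AB the point C lies, and it vanishes iff A, B, C are aligned. *)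
Definition orient (R : realType) (A B C : 'rV[R]_2) : R :=
  (B 0 0 - A 0 0) * (C 0 1 - A 0 1) - (B 0 1 - A 0 1) * (C 0 0 - A 0 0).

(* P lists, in cyclic order (ordS is the cyclic successor on 'I_n), the      *)
(* vertices of a convex n-gon: for every side, all the vertices other than   *)
(* its endpoints lie strictly on the same side of the line it spans.  Both   *)
(* orientations are allowed.  Taking k = l shows that no other vertex is on  *)
(* that line, so there are no repeated vertices and no straight angles, and  *)
(* the polygonal region is the convex hull of the vertices.                  *)
Definition convex_polygon (R : realType) (n : nat) (P : 'I_n -> 'rV[R]_2) :
    Prop :=
  (3 <= n)%N /\
  forall j k l : 'I_n,
    k != j -> k != ordS j -> l != j -> l != ordS j ->
    0 < orient (P j) (P (ordS j)) (P k) * orient (P j) (P (ordS j)) (P l).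

(* The line AB meets the circle in exactly one point, which is on side AB.   *)
Definition tangent_side (R : realType) (A B c : 'rV[R]_2) (r : R) : Prop :=
  exists2 T, segment A B T & line A B `&` circle c r = [set T].

Definition circumscribed (R : realType) (n : nat) (P : 'I_n -> 'rV[R]_2)
    (c : 'rV[R]_2) (r : R) : Prop :=
  circle c r `<=` convex_hull P /\
  forall j : 'I_n, tangent_side (P j) (P (ordS j)) c r.

(* With the family a_1, ..., a_n stored as a : 'I_n -> R, a_j = a (j - 1),   *)
(* this is a_1 - a_2 + ... + (-1)^(k-1) a_k, for k <= n.                     *)
Definition alt_prefix (R : realType) (n : nat) (a : 'I_n -> R) (k : nat) : R :=
  \sum_(i < n | (i < k)%N) (-1) ^+ i * a i.

(* The cyclic alternating sum of l consecutive terms starting at index j.    *)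
Definition alt_cyclic (R : realType) (n : nat) (a : 'I_n -> R) (j : 'I_n)
    (l : nat) : R :=
  \sum_(m < l) (-1) ^+ m * a (iter m (@ordS n) j).

(* Main.v *)
(* For a polygon circumscribed about a circle, let t_j be the length of the two
   tangents from the vertex P_j; then a_j = t_j + t_(j+1), and an alternating sum
   of l consecutive sides telescopes to t_j - (-1)^l t_(j+l).  This yields all the
   inequalities, and conversely any t_1 strictly between the even and the odd
   prefix sums determines positive t_j.
   Given the t_j, the sum of the angles atan (t_j / r) is continuous in 1 / r,
   vanishes at 0 and is at least n pi / 4 >= pi for small r, so for some r it
   equals pi: the right-angled kites with sides r, t_j, t_j, r then close up
   around the centre.  A vertex k lies strictly inside the side with contact
   angle phi because the angle from phi to P_k is between u_k and 2 pi - u_k,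
   where u_k = atan (t_k / r), and each arc of the circle between two contact
   points lies in the triangle they form with the corner between them. *)
From HB Require Import structures.
From mathcomp Require Import all_boot all_order all_algebra.
From mathcomp Require Import ring lra zify.
From mathcomp Require Import all_classical all_reals.
From mathcomp Require Import topology normedtype trigo.
Require Import Defs.
Import Order.TTheory GRing.Theory Num.Theory.
Import numFieldNormedType.Exports.
Local Open Scope classical_set_scope.
Local Open Scope ring_scope.

Set Implicit Arguments.
Unset Strict Implicit.
Unset Printing Implicit Defensive.

(** * Cyclic indices, alternating sums and tangent lengths *)

Lemma val_iter_ordS n (j : 'I_n) m : iter m (@ordS n) j = ((j + m) %% n)%N :> nat.
Proof.
elim: m => [|m IHm]; first by rewrite addn0 modn_small.
by rewrite iterS /= IHm -addn1 modnDml addn1 addnS.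
Qed.

Lemma iter_ordS_first n (i0 j : 'I_n) : i0 = 0%N :> nat -> iter j (@ordS n) i0 = j.
Proof. by move=> i00; apply: val_inj; rewrite /= val_iter_ordS i00 add0n modn_small. Qed.

Lemma iter_ordS_loop n (j : 'I_n) : iter n (@ordS n) j = j.
Proof. by apply: val_inj; rewrite /= val_iter_ordS modnDr modn_small. Qed.

Lemma alt_cyclicS (R : realType) n (a : 'I_n -> R) j l :
  alt_cyclic a j l.+1 = alt_cyclic a j l + (-1) ^+ l * a (iter l (@ordS n) j).
Proof. by rewrite /alt_cyclic big_ord_recr. Qed.

Lemma alt_cyclicD (R : realType) n (a : 'I_n -> R) j p q :
  alt_cyclic a j (p + q) =
  alt_cyclic a j p + (-1) ^+ p * alt_cyclic a (iter p (@ordS n) j) q.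
Proof.
rewrite /alt_cyclic big_split_ord /= mulr_sumr; congr (_ + _).
by apply: eq_bigr => m _; rewrite exprD mulrA addnC iterD.
Qed.

Lemma alt_prefix_cyclic (R : realType) n (a : 'I_n -> R) (i0 : 'I_n) k :
  i0 = 0%N :> nat -> (k <= n)%N -> alt_prefix a k = alt_cyclic a i0 k.
Proof.
move=> i00 kn; rewrite /alt_prefix (big_ord_narrow kn); apply: eq_bigr => m _.
by rewrite -[m : nat]/(widen_ord kn m : nat) iter_ordS_first.
Qed.

Lemma alt_cyclic_tangent (R : realType) n (a t : 'I_n -> R) j l :
  (forall i, a i = t i + t (ordS i)) ->
  alt_cyclic a j l = t j - (-1) ^+ l * t (iter l (@ordS n) j).
Proof.
move=> at_; elim: l => [|l IHl]; first by rewrite /alt_cyclic big_ord0 mul1r subrr.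
by rewrite alt_cyclicS IHl at_ exprS iterS; ring.
Qed.

Lemma tangent_alt_cyclic_gt0 (R : realType) n (a t : 'I_n -> R) j l :
  (forall i, 0 < t i) -> (forall i, a i = t i + t (ordS i)) -> odd l ->
  0 < alt_cyclic a j l.
Proof.
move=> t0 at_ ol; rewrite (alt_cyclic_tangent _ _ at_) -signr_odd ol.
by rewrite expr1 mulN1r opprK addr_gt0.
Qed.

Lemma tangent_alt_prefix0 (R : realType) n (a t : 'I_n -> R) :
  ~~ odd n -> (forall i, a i = t i + t (ordS i)) -> alt_prefix a n = 0.
Proof.
case: n a t => [|n] a t en at_; first by rewrite /alt_prefix big_ord0.
rewrite (alt_prefix_cyclic a (i0 := ord0)) // (alt_cyclic_tangent _ _ at_).
by rewrite -signr_odd (negPf en) iter_ordS_loop mul1r subrr.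
Qed.

(** The first tangent length [t ord0] separates the two sides: it exceeds each even prefix sum, and
    is exceeded by each odd one, by the positive tangent length that follows the prefix. *)
Lemma tangent_alt_prefix_sep (R : realType) n (a t : 'I_n -> R) :
  (2 <= n)%N -> (forall i, 0 < t i) -> (forall i, a i = t i + t (ordS i)) ->
  \big[Num.max/0]_(1 <= k < n | ~~ odd k) alt_prefix a k <
  \big[Num.min/alt_prefix a 1]_(1 <= k < n | odd k) alt_prefix a k.
Proof.
case: n a t => // n a t n2 t0 at_.
have pfx k : (k <= n.+1)%N ->
    alt_prefix a k = t ord0 - (-1) ^+ k * t (iter k (@ordS n.+1) ord0).
  by move=> kn; rewrite (alt_prefix_cyclic a (i0 := ord0)) // (alt_cyclic_tangent _ _ at_).
apply: (@lt_trans _ _ (t ord0)).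
  rewrite big_nat_cond; apply: bigmax_lt => // k /andP[/andP[_ /ltnW kn] ek].
  by rewrite pfx // -signr_odd (negPf ek) mul1r gtrBl.
have odd_gt k : odd k -> (k <= n.+1)%N -> t ord0 < alt_prefix a k.
  by move=> ok kn; rewrite pfx // -signr_odd ok mulN1r opprK ltrDl.
rewrite big_nat_cond; apply: lt_bigmin => [|k /andP[/andP[_ /ltnW kn] ok]]; exact: odd_gt.
Qed.

(** Once the first tangent length is chosen, the relations force all the others to be $\pm$ its
    difference with a prefix sum; the gap makes them positive, and the vanishing total makes them
    consistent around the cycle. *)
Lemma alt_prefix_sep_tangent (R : realType) n (a : 'I_n -> R) :
  (0 < n)%N -> ~~ odd n -> alt_prefix a n = 0 ->
  \big[Num.max/0]_(1 <= k < n | ~~ odd k) alt_prefix a k <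
  \big[Num.min/alt_prefix a 1]_(1 <= k < n | odd k) alt_prefix a k ->
  exists t : 'I_n -> R,
    (forall j, 0 < t j) /\ (forall j, a j = t j + t (ordS j)).
Proof.
case: n a => // n a _ en an0.
set M := (X in X < _); set m := (X in _ < X) => Mm.
have S0 : alt_prefix a 0 = 0 by rewrite /alt_prefix big_pred0.
have S_ (j : 'I_n.+1) : alt_prefix a j.+1 = alt_prefix a j + (-1) ^+ j * a j.
  rewrite !(alt_prefix_cyclic a (i0 := ord0)) ?(ltnW (ltn_ord j)) //.
  by rewrite alt_cyclicS iter_ordS_first.
have max0 : 0 <= M by rewrite /M; exact: bigmax_ge_id.
(* Any value strictly between [M] and [m] would do. *)
pose t0 := (M + m) / 2.
exists (fun j => (-1) ^+ j * (t0 - alt_prefix a j)); split=> j.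
  rewrite -signr_odd; case: (boolP (odd j)) => oj.
    rewrite expr1 mulN1r opprB subr_gt0; apply: (@lt_le_trans _ _ m).
      by rewrite /t0; lra.
    apply: ge_bigmin_seq; last by [].
    by rewrite mem_index_iota ltn_ord odd_gt0.
  rewrite mul1r subr_gt0; apply: (@le_lt_trans _ _ M); last by rewrite /t0; lra.
  (* The empty prefix is outside the range of the maximum, but its value is the default 0. *)
  case: (posnP j) => [->|j0]; first by rewrite S0.
  apply: le_bigmax_seq; last by [].
  by rewrite mem_index_iota ltn_ord j0.
have sgn2 : (-1) ^+ j * (-1) ^+ j = 1 :> R by rewrite -exprMn mulN1r opprK expr1n.
(* At the last index [ordS] returns to 0, and the relation holds because the total alternating sum
   is 0. *)
rewrite /=; move: (S_ j); have [->|jn] := eqVneq (val j) n => Sj.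
  have on : odd n by rewrite /= negbK in en.
  rewrite modnn expr0 S0; move: Sj; rewrite an0 -signr_odd on expr1 => Sj.
  lra.
have jn' : (j.+1 < n.+1)%N by rewrite ltn_neqAle ltn_ord andbT eqSS.
rewrite modn_small // Sj exprS.
transitivity ((-1) ^+ j * (-1) ^+ j * a j); last by ring.
by rewrite sgn2 mul1r.
Qed.

(** The prefix sum at an odd [p] minus that at an even [q] is a cyclic sum of odd length starting at
    ordinal [q], which wraps around when [p < q]. So sums with even starting ordinal suffice. *)
Lemma alt_cyclic_even_sep (R : realType) n (a : 'I_n -> R) :
  (2 <= n)%N -> ~~ odd n -> alt_prefix a n = 0 ->
  (forall (j : 'I_n) l, ~~ odd j -> odd l -> (1 <= l <= n - 1)%N ->
     0 < alt_cyclic a j l) ->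
  \big[Num.max/0]_(1 <= k < n | ~~ odd k) alt_prefix a k <
  \big[Num.min/alt_prefix a 1]_(1 <= k < n | odd k) alt_prefix a k.
Proof.
case: n a => // n a n2 en an0 pos.
have pfx := alt_prefix_cyclic a (erefl : ord0 = 0%N :> nat).
have lt_pfx p q : odd p -> ~~ odd q -> (p < n.+1)%N -> (q < n.+1)%N ->
    alt_prefix a q < alt_prefix a p.
  move=> op eq_ pn qn; pose j := Ordinal qn.
  have itq : iter q (@ordS _) ord0 = j by exact: (@iter_ordS_first _ ord0 j).
  have sq : (-1) ^+ q = 1 :> R by rewrite -signr_odd (negPf eq_).
  have split_q k : (q <= k <= n.+1)%N ->
      alt_prefix a k = alt_prefix a q + alt_cyclic a j (k - q).
    move=> /andP[qk kn]; rewrite (pfx k) // (pfx q) ?(ltnW qn) //.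
    by rewrite -{1}(subnKC qk) alt_cyclicD itq sq mul1r.
  have /orP[pq|qp] := leq_total p q; last first.
    rewrite (split_q p) ?qp ?(ltnW pn) // ltrDl; apply: pos => //.
      by rewrite oddB // op (negPf eq_).
    by move: op eq_ {sq itq}; lia.
  (* Going once around the polygon costs [alt_prefix a n = 0]. *)
  have en_q : ~~ odd (n.+1 - q) by rewrite oddB ?(ltnW qn) // (negPf en) (negPf eq_).
  have itn : iter (n.+1 - q) (@ordS _) j = ord0.
    by rewrite -itq -iterD subnK ?iter_ordS_loop // ltnW.
  have : 0 < alt_cyclic a j (n.+1 - q + p).
    apply: pos => //; first by rewrite oddD (negPf en_q) op.
    by move: op eq_ {sq itq itn split_q}; lia.
  rewrite alt_cyclicD itn -signr_odd (negPf en_q) mul1r -pfx ?(ltnW pn) //.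
  have := split_q n.+1; rewrite leqnn (ltnW qn) an0 => /(_ isT); lra.
have S0 : alt_prefix a 0 = 0 by rewrite /alt_prefix big_pred0.
have sep p : odd p -> (p < n.+1)%N ->
    \big[Num.max/0]_(1 <= k < n.+1 | ~~ odd k) alt_prefix a k < alt_prefix a p.
  move=> op pn; rewrite big_nat_cond; apply: bigmax_lt => [|q /andP[/andP[_ qn] eq_]].
    by rewrite -S0; exact: lt_pfx.
  exact: lt_pfx.
rewrite [ltRHS]big_nat_cond; apply: lt_bigmin => [|p /andP[/andP[_ pn] op]]; exact: sep.
Qed.

(** * From a circumscribed polygon to its tangent lengths *)

Definition sqdist (R : realType) (A B : 'rV[R]_2) : R :=
  (B 0 0 - A 0 0) ^+ 2 + (B 0 1 - A 0 1) ^+ 2.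

Definition dotp (R : realType) (A B C D : 'rV[R]_2) : R :=
  (B 0 0 - A 0 0) * (D 0 0 - C 0 0) + (B 0 1 - A 0 1) * (D 0 1 - C 0 1).

Lemma sqdist_ge0 (R : realType) (A B : 'rV[R]_2) : 0 <= sqdist A B.
Proof. by rewrite addr_ge0 ?sqr_ge0. Qed.

Lemma edist_sqrt (R : realType) (A B : 'rV[R]_2) :
  edist A B = Num.sqrt (sqdist A B).
Proof.
rewrite /edist big_ord_recl big_ord1 /sqdist.
by rewrite (_ : lift ord0 ord0 = 1) //; apply: val_inj.
Qed.

Lemma circleP (R : realType) (c X : 'rV[R]_2) (r : R) : 0 < r ->
  circle c r X <-> sqdist c X = r ^+ 2.
Proof.
move=> r0; rewrite /circle /= edist_sqrt; split=> [<-|->].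
  by rewrite sqr_sqrtr // sqdist_ge0.
by rewrite sqrtr_sqr gtr0_norm.
Qed.

Lemma row2P (R : realType) (A B : 'rV[R]_2) :
  A 0 0 = B 0 0 -> A 0 1 = B 0 1 -> A = B.
Proof.
move=> AB0 AB1; apply/rowP => -[[|[|//]] i2].
  by rewrite (_ : Ordinal i2 = 0) //; apply: val_inj.
by rewrite (_ : Ordinal i2 = 1) //; apply: val_inj.
Qed.

(* The reflection of X in the foot of the perpendicular from c is a second
   common point unless X is that foot. *)
Lemma line_circle_orth (R : realType) (A B c T X : 'rV[R]_2) (r : R) :
  0 < r -> line A B `&` circle c r = [set T] ->
  (line A B `&` circle c r) X -> dotp c X A B = 0.
Proof.
move=> r0 ABcT ABcX; have XT : X = T by rewrite ABcT in ABcX.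
case: (ABcX) => -[s Xs] /circleP - /(_ r0) cX.
have X_ i : X 0 i = (1 - s) * A 0 i + s * B 0 i by rewrite Xs !mxE.
apply/eqP/negPn/negP => p0.
set p := dotp _ _ _ _ in p0; pose D := sqdist A B.
have D0 : D != 0.
  apply: contraNneq p0 => /eqP; rewrite /D /sqdist paddr_eq0 ?sqr_ge0 //.
  by rewrite !sqrf_eq0 => /andP[/eqP d0 /eqP d1]; rewrite /p /dotp d0 d1 !mulr0 addr0.
(* A shift of the parameter by [u] changes the squared distance to [c] by [u * (2 * p + u * D)];
   this is its nonzero root. *)
pose u := - 2 * p / D.
have uD : u * D = - 2 * p by rewrite /u divfK.
pose Y : 'rV[R]_2 := (1 - (s + u)) *: A + (s + u) *: B.
have Y_ i : Y 0 i = X 0 i + u * (B 0 i - A 0 i) by rewrite X_ !mxE; ring.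
have YT : Y = T.
  suff : (line A B `&` circle c r) Y by rewrite ABcT.
  split; first by exists (s + u).
  apply/circleP => //; rewrite -cX /sqdist !Y_.
  have -> : forall x0 x1 d0 d1, (x0 + u * d0 - c 0 0) ^+ 2 + (x1 + u * d1 - c 0 1) ^+ 2
    = (x0 - c 0 0) ^+ 2 + (x1 - c 0 1) ^+ 2
      + u * (2 * ((x0 - c 0 0) * d0 + (x1 - c 0 1) * d1) + u * (d0 ^+ 2 + d1 ^+ 2)).
    by move=> *; ring.
  by rewrite -/(sqdist A B) -/(dotp c X A B) -/p -/D uD mulNr subrr mulr0 addr0.
have u0 : u != 0 by rewrite /u !mulf_neq0 ?invr_eq0 // oppr_eq0 pnatr_eq0.
have d_ i : B 0 i - A 0 i = 0.
  have := Y_ i; rewrite YT XT => /eqP; rewrite -subr_eq0 opprD addNKr oppr_eq0.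
  by rewrite mulf_eq0 (negPf u0) => /eqP.
by move: p0; rewrite /p /dotp !d_ !mulr0 addr0 eqxx.
Qed.

(** By Pythagoras at the contact point, the two square roots are the distances from it to [A] and to
    [B]; they add up to the side because the contact point lies on the segment. *)
Lemma tangent_side_length (R : realType) (A B c : 'rV[R]_2) (r : R) :
  0 < r -> tangent_side A B c r ->
  [/\ r ^+ 2 <= sqdist c A, r ^+ 2 <= sqdist c B &
   edist A B = Num.sqrt (sqdist c A - r ^+ 2) + Num.sqrt (sqdist c B - r ^+ 2)].
Proof.
move=> r0 [T [s [/andP[s0 s1] Ts]] ABcT].
have ABcTT : (line A B `&` circle c r) T by rewrite ABcT.
have p0 := line_circle_orth r0 ABcT ABcTT.
case: ABcTT => _ /circleP - /(_ r0) cT.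
have T_ i : T 0 i = (1 - s) * A 0 i + s * B 0 i by rewrite Ts !mxE.
have cA : sqdist c A - r ^+ 2 = s ^+ 2 * sqdist A B.
  have -> : sqdist c A = sqdist c T - 2 * s * dotp c T A B + s ^+ 2 * sqdist A B.
    by rewrite /sqdist /dotp !T_; ring.
  by rewrite p0 cT; ring.
have cB : sqdist c B - r ^+ 2 = (1 - s) ^+ 2 * sqdist A B.
  have -> : sqdist c B =
      sqdist c T + 2 * (1 - s) * dotp c T A B + (1 - s) ^+ 2 * sqdist A B.
    by rewrite /sqdist /dotp !T_; ring.
  by rewrite p0 cT; ring.
have le_s (x y : R) : x - r ^+ 2 = y ^+ 2 * sqdist A B -> r ^+ 2 <= x.
  by move=> xE; rewrite -subr_ge0 xE mulr_ge0 ?sqr_ge0 ?sqdist_ge0.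
split; [exact: le_s cA | exact: le_s cB | rewrite cA cB edist_sqrt].
rewrite (sqrtrM _ (sqr_ge0 s)) (sqrtrM _ (sqr_ge0 (1 - s))) !sqrtr_sqr !ger0_norm ?subr_ge0 //; ring.
Qed.

(* Otherwise both sides would lie on the tangent line at B. *)
Lemma corner_off_circle (R : realType) (A B C c : 'rV[R]_2) (r : R) :
  0 < r -> tangent_side A B c r -> tangent_side B C c r ->
  orient A B C != 0 -> sqdist c B != r ^+ 2.
Proof.
move=> r0 [T _ AB] [U _ BC]; apply: contra_neq => cB.
have inAB : (line A B `&` circle c r) B.
  by split; [exists 1; rewrite subrr scale0r add0r scale1r | exact/circleP].
have inBC : (line B C `&` circle c r) B.
  by split; [exists 0; rewrite subr0 scale0r addr0 scale1r | exact/circleP].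
have := line_circle_orth r0 AB inAB; have := line_circle_orth r0 BC inBC.
move: cB; rewrite /sqdist /dotp /orient.
set v0 := B 0 0 - c 0 0; set v1 := B 0 1 - c 0 1 => cB q0 p0.
have r2 : r ^+ 2 != 0 by rewrite sqrf_eq0 gt_eqF.
apply: (mulfI r2); rewrite mulr0 -cB.
set d0 := B 0 0 - A 0 0 in p0 *; set d1 := B 0 1 - A 0 1 in p0 *.
have -> : C 0 0 - A 0 0 = d0 + (C 0 0 - B 0 0) by rewrite /d0; ring.
have -> : C 0 1 - A 0 1 = d1 + (C 0 1 - B 0 1) by rewrite /d1; ring.
set e0 := C 0 0 - B 0 0 in q0 *; set e1 := C 0 1 - B 0 1 in q0 *.
(* The plane identity $|v|^2 (d \times e) = (v \cdot d)(v \times e) - (v \cdot e)(v \times d)$; both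
   dot products vanish by tangency. *)
transitivity ((v0 * d0 + v1 * d1) * (v0 * e1 - v1 * e0)
              - (v0 * e0 + v1 * e1) * (v0 * d1 - v1 * d0)); first by ring.
by rewrite p0 q0 !mul0r subrr.
Qed.

Lemma iter_ordS_neq n (j : 'I_n) m : (0 < m < n)%N -> iter m (@ordS n) j != j.
Proof.
move=> mn; apply/eqP => /(congr1 val); rewrite /= val_iter_ordS.
have jn := ltn_ord j; have [jm|jm] := ltnP (j + m) n.
  by rewrite modn_small //; lia.
by rewrite -(subnK jm) modnDr modn_small; lia.
Qed.

Lemma circumscribed_tangent (R : realType) n (P : 'I_n -> 'rV[R]_2) c r
    (a : 'I_n -> R) :
  convex_polygon P -> 0 < r -> circumscribed P c r ->
  (forall j, edist (P j) (P (ordS j)) = a j) ->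
  exists t : 'I_n -> R,
    (forall j, 0 < t j) /\ (forall j, a j = t j + t (ordS j)).
Proof.
move=> [n3 cvx] r0 [_ tgt] lenP.
exists (fun j => Num.sqrt (sqdist c (P j) - r ^+ 2)); split=> j; last first.
  by rewrite -lenP; have [] := tangent_side_length r0 (tgt j).
have [le_r _ _] := tangent_side_length r0 (tgt j).
rewrite sqrtr_gt0 subr_gt0 lt_neqAle le_r andbT eq_sym.
rewrite -(ord_predK j); set i := ord_pred j.
apply: (corner_off_circle r0 (tgt i) (tgt (ordS i))).
(* As $n \ge 3$, the vertex two steps after [i] is a third one; convexity with [k = l] then makes
   the square of the orientation positive. *)
have ne1 : ordS (ordS i) != i by apply: (@iter_ordS_neq _ i 2).
have ne2 : ordS (ordS i) != ordS i.
  by apply: (@iter_ordS_neq _ (ordS i) 1); apply: ltnW.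
have := cvx i _ _ ne1 ne2 ne1 ne2.
by apply: contraTneq => ->; rewrite mul0r ltxx.
Qed.

(** * Points of the convex hull *)

Lemma convex_hull_vertex (R : realType) n (P : 'I_n -> 'rV[R]_2) j :
  convex_hull P (P j).
Proof.
exists (fun i => (i == j)%:R); split=> [i||]; first exact: ler0n.
  by rewrite (bigD1 j) //= eqxx big1 ?addr0 // => i /negPf ->.
rewrite (bigD1 j) //= eqxx scale1r big1 ?addr0 // => i /negPf ->.
by rewrite scale0r.
Qed.

Lemma convex_hull_comb3 (R : realType) n (P : 'I_n -> 'rV[R]_2) A B C (x y z : R) :
  convex_hull P A -> convex_hull P B -> convex_hull P C ->
  0 <= x -> 0 <= y -> 0 <= z -> x + y + z = 1 ->
  convex_hull P (x *: A + y *: B + z *: C).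
Proof.
move=> [u [u0 u1 ->]] [v [v0 v1 ->]] [w [w0 w1 ->]] x0 y0 z0 xyz.
exists (fun i => x * u i + y * v i + z * w i); split=> [i||].
- by rewrite !addr_ge0 ?mulr_ge0.
- by rewrite !big_split /= -!mulr_sumr u1 v1 w1 !mulr1.
- rewrite !scaler_sumr -!big_split /=; apply: eq_bigr => i _.
  by rewrite !scalerDl !scalerA.
Qed.

Lemma segment_convex_hull (R : realType) n (P : 'I_n -> 'rV[R]_2) i j X :
  segment (P i) (P j) X -> convex_hull P X.
Proof.
move=> [s [/andP[s0 s1] ->]]; rewrite -[_ + _]addr0 -(scale0r (P i)).
apply: convex_hull_comb3; try exact: convex_hull_vertex => //.
- by rewrite subr_ge0.
- exact: s0.
- exact: lexx.
- ring.
Qed.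

(** * Polar coordinates, arcs and tangent lines *)

Definition polar (R : realType) (r x : R) : 'rV[R]_2 :=
  \row_(i < 2) if i == 0 then r * cos x else r * sin x.

Lemma polarE0 (R : realType) (r x : R) : polar r x 0 0 = r * cos x.
Proof. by rewrite mxE. Qed.

Lemma polarE1 (R : realType) (r x : R) : polar r x 0 1 = r * sin x.
Proof. by rewrite mxE. Qed.

Lemma sqdist0 (R : realType) (X : 'rV[R]_2) :
  sqdist 0 X = X 0 0 ^+ 2 + X 0 1 ^+ 2.
Proof. by rewrite /sqdist !mxE !subr0. Qed.

Lemma polar_on_circle (R : realType) (r x : R) : 0 < r -> circle 0 r (polar r x).
Proof.
move=> r0; apply/circleP => //; rewrite sqdist0 polarE0 polarE1 !exprMn -mulrDr.
by rewrite cos2Dsin2 mulr1.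
Qed.

Lemma unit_vector_angle (R : realType) (x y : R) : x ^+ 2 + y ^+ 2 = 1 ->
  exists2 u, 0 <= u <= pi *+ 2 & x = cos u /\ y = sin u.
Proof.
move=> xy1; have x1 : -1 <= x <= 1.
  rewrite -ler_norml -(@expr_le1 _ 2) // -normrX ger0_norm ?sqr_ge0 //.
  by move: (sqr_ge0 y); lra.
have cosx : cos (acos x) = x by rewrite acosK // in_itv.
have sinx : sin (acos x) = `|y|.
  by rewrite sin_acos // (_ : 1 - _ = y ^+ 2) ?sqrtr_sqr //; lra.
have a0 := acos_ge0 x1; have api := acos_lepi x1; have pi0 := pi_ge0 R.
have [y0|y0] := leP 0 y.
  exists (acos x); first by apply/andP; split=> //; lra.
  by rewrite cosx sinx ger0_norm.
exists (pi *+ 2 - acos x); first by apply/andP; split; lra.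
rewrite cosB sinB cos2pi sin2pi cosx sinx ltr0_norm //; split; ring.
Qed.

(** Cosine is symmetric about [pi]: a [v] beyond [pi] is replaced by [pi *+ 2 - v], which still
    exceeds [u], and cosine decreases on $[0, \pi]$. *)
Lemma ltr_cos_arc (R : realType) (u v : R) :
  0 <= u -> u < v < pi *+ 2 - u -> cos v < cos u.
Proof.
move=> u0 /andP[uv vu]; have [vpi|piv] := leP v pi.
  by rewrite ltr_cos ?in_itv /=; lra.
have <- : cos (pi *+ 2 - v) = cos v by rewrite cosB cos2pi sin2pi; ring.
rewrite ltr_cos ?in_itv /=; lra.
Qed.

(** The weights are the barycentric coordinates of the arc point in the triangle formed by the two
    contact points and the corner. The corner's weight is nonnegative exactly when $\cos u \le \cos
    v$. *)
Lemma arc_corner_comb (R : realType) (r u v x : R) :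
  0 < u < pi / 2 -> - u <= v <= u ->
  exists p : R * R * R,
    [/\ 0 <= p.1.1, 0 <= p.1.2, 0 <= p.2, p.1.1 + p.1.2 + p.2 = 1 &
     polar r (x + v) = p.1.1 *: polar r (x + u) + p.1.2 *: polar r (x - u)
                       + p.2 *: polar (r / cos u) x].
Proof.
move=> /andP[u0 upi] uv.
have su0 : 0 < sin u by apply: sin_gt0_pihalf; rewrite u0.
have cu0 : 0 < cos u by apply: cos_gt0_pihalf; lra.
have cuv : cos u <= cos v.
  have := uv; rewrite -ler_norml -(cos_norm v) le_eqVlt => /predU1P[-> //|vu].
  apply/ltW; rewrite ltr_cos ?in_itv /=; first exact: vu.
    by have := normr_ge0 v; lra.
  by apply/andP; split; lra.
have cs : sin u ^+ 2 = 1 - cos u ^+ 2 by exact: sin2cos2.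
pose d := 2 * sin u ^+ 2.
have d0 : 0 < d by rewrite mulr_gt0 ?exprn_gt0.
(* Solution of the system given by [pBq] and [pqu]: the components of the point across and along the
   bisector at angle [x]. *)
pose p := (1 - cos (u + v)) / d; pose q := (1 - cos (u - v)) / d.
have pq : p + q = (1 - cos u * cos v) / sin u ^+ 2.
  by rewrite /p /q /d cosD cosB; field; rewrite gt_eqF.
have pBq : (p - q) * sin u = sin v.
  by rewrite /p /q /d cosD cosB; field; rewrite gt_eqF.
have pqu : (p + q) * cos u + (1 - (p + q)) / cos u = cos v.
  rewrite pq; apply: (mulfI (lt0r_neq0 cu0)).
  have s20 : 1 - cos u ^+ 2 != 0 by rewrite -cs sqrf_eq0 gt_eqF.
  by rewrite cs; field; rewrite s20 gt_eqF.
exists (p, q, 1 - (p + q)); split=> /=.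
- by rewrite divr_ge0 ?(ltW d0) // subr_ge0 cos_le1.
- by rewrite divr_ge0 ?(ltW d0) // subr_ge0 cos_le1.
- rewrite subr_ge0 pq ler_pdivrMr ?exprn_gt0 // mul1r cs lerD2l lerN2 expr2.
  by rewrite ler_pM2l.
- ring.
- apply: row2P; rewrite !mxE /= ?cosD ?cosB ?sinD ?sinB ?cosN ?sinN.
    transitivity (r * (cos x * ((p + q) * cos u + (1 - (p + q)) / cos u)
                       - sin x * ((p - q) * sin u))); last by ring.
    by rewrite pqu pBq.
  transitivity (r * (sin x * ((p + q) * cos u + (1 - (p + q)) / cos u)
                     + cos x * ((p - q) * sin u))); last by ring.
  by rewrite pqu pBq.
Qed.

(* The point at signed distance t, counterclockwise, from the contact point of
   the tangent to the circle of centre 0 and radius r at angle x. *)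
Definition on_tangent (R : realType) (r x t : R) : 'rV[R]_2 :=
  \row_(i < 2) if i == 0 then r * cos x - t * sin x else r * sin x + t * cos x.

Lemma on_tangentE0 (R : realType) (r x t : R) :
  on_tangent r x t 0 0 = r * cos x - t * sin x.
Proof. by rewrite mxE. Qed.

Lemma on_tangentE1 (R : realType) (r x t : R) :
  on_tangent r x t 0 1 = r * sin x + t * cos x.
Proof. by rewrite mxE. Qed.

(** The hypotheses say $t = r \tan u$, so the tangents at angles [x + u] and [x - u] meet at angle
    [x], at distance [t] from both contact points. *)
Lemma corner_on_tangent (R : realType) (r u t x : R) :
  cos u != 0 -> t * cos u = r * sin u ->
  polar (r / cos u) x = on_tangent r (x + u) (- t) /\
  polar (r / cos u) x = on_tangent r (x - u) t.
Proof.
move=> cu tu; have -> : t = r * sin u / cos u by rewrite -tu mulfK.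
have cs : r / cos u = r / cos u * (cos u ^+ 2 + sin u ^+ 2).
  by rewrite cos2Dsin2 mulr1.
split; apply: row2P; rewrite ?polarE0 ?polarE1 ?on_tangentE0 ?on_tangentE1;
  rewrite {1}cs ?cosD ?cosB ?sinD ?sinB ?cosN ?sinN; by field.
Qed.

(** The last factor is the signed distance from [X] to the tangent line, positive on the side of the
    centre when [r] is positive. *)
Lemma on_tangent_orient (R : realType) (r x t t' : R) X :
  orient (on_tangent r x (- t)) (on_tangent r x t') X =
  (t + t') * (r - (X 0 0 * cos x + X 0 1 * sin x)).
Proof.
rewrite /orient !on_tangentE0 !on_tangentE1.
transitivity ((t + t') * (r * (cos x ^+ 2 + sin x ^+ 2)
                          - (X 0 0 * cos x + X 0 1 * sin x))); first by ring.
by rewrite cos2Dsin2 mulr1.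
Qed.

Lemma on_tangent_edist (R : realType) (r x t t' : R) : 0 <= t + t' ->
  edist (on_tangent r x (- t)) (on_tangent r x t') = t + t'.
Proof.
move=> tt'; rewrite edist_sqrt /sqdist !on_tangentE0 !on_tangentE1.
have -> : forall c s, (r * c - t' * s - (r * c - - t * s)) ^+ 2
    + (r * s + t' * c - (r * s + - t * c)) ^+ 2 = (t + t') ^+ 2 * (c ^+ 2 + s ^+ 2).
  by move=> *; ring.
by rewrite cos2Dsin2 mulr1 sqrtr_sqr ger0_norm.
Qed.

Lemma on_tangent_line (R : realType) (r x t t' s : R) :
  (1 - s) *: on_tangent r x (- t) + s *: on_tangent r x t' =
  on_tangent r x (s * (t + t') - t).
Proof. by apply: row2P; rewrite !mxE /=; ring. Qed.

Lemma on_tangent_segment (R : realType) (r x t t' : R) : 0 < t -> 0 < t' ->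
  segment (on_tangent r x (- t)) (on_tangent r x t') (polar r x).
Proof.
move=> t0 t'0; exists (t / (t + t')); split.
  have tt' := addr_gt0 t0 t'0; apply/andP; split; first exact/ltW/divr_gt0.
  by rewrite ler_pdivrMr // mul1r lerDl ltW.
rewrite on_tangent_line divfK ?gt_eqF ?addr_gt0 // subrr.
by apply: row2P; rewrite !mxE /= mul0r ?subr0 ?addr0.
Qed.

Lemma on_tangent_side (R : realType) (r x t t' : R) : 0 < r -> 0 < t -> 0 < t' ->
  tangent_side (on_tangent r x (- t)) (on_tangent r x t') 0 r.
Proof.
move=> r0 t0 t'0; have seg := on_tangent_segment r x t0 t'0.
exists (polar r x) => //; apply/seteqP; split=> [X [] [s ->]|_ ->] /=.
  rewrite on_tangent_line; set d := _ - t => /circleP - /(_ r0).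
  rewrite sqdist0 on_tangentE0 on_tangentE1.
  have -> : forall c s, (r * c - d * s) ^+ 2 + (r * s + d * c) ^+ 2
      = (r ^+ 2 + d ^+ 2) * (c ^+ 2 + s ^+ 2) by move=> *; ring.
  rewrite cos2Dsin2 mulr1 => /eqP; rewrite -subr_eq0 addrAC subrr add0r.
  rewrite sqrf_eq0 => /eqP ->.
  by apply: row2P; rewrite !mxE /= mul0r ?subr0 ?addr0.
split; last exact: polar_on_circle.
by have [s [_ Es]] := seg; exists s.
Qed.

(** * Choice of the radius and construction of the polygon *)

Lemma exists_half_angles (R : realType) n (t : 'I_n -> R) :
  (4 <= n)%N -> (forall i, 0 < t i) ->
  exists r, exists2 u : 'I_n -> R,
    0 < r /\ \sum_i u i = pi &
    forall i, 0 < u i < pi / 2 /\ t i * cos (u i) = r * sin (u i).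
Proof.
move=> n4 t0; pose f (x : R) := \sum_i atan (x * t i).
have cf : continuous f.
  apply: continuous_big => [|i _]; first exact: add_continuous.
  move=> x; apply: continuous_comp; last exact: continuous_atan.
  exact: mulrr_continuous.
(* Here [x] stands for [1 / r]. This [M] makes every [M * t i] at least 1, so each arctangent is at
   least [pi / 4], and there are at least four of them. *)
pose M := \sum_i (t i)^-1.
have Mt i : 1 <= M * t i.
  rewrite -ler_pdivrMr // div1r /M (bigD1 i) //= lerDl sumr_ge0 // => k _.
  by rewrite invr_ge0 ltW.
have f0 : f 0 = 0 by rewrite /f big1 // => i _; rewrite mul0r atan0.
have fM : pi <= f M.
  apply: (@le_trans _ _ (\sum_(i < n) (pi / 4))).
    rewrite sumr_const card_ord -[leRHS]mulr_natr -mulrA ler_peMr ?pi_ge0 //.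
    by rewrite mulrC ler_pdivlMr // mul1r ler_nat.
  by apply: ler_sum => i _; rewrite -atan1; exact: le_atan.
have M0 : 0 <= M by rewrite sumr_ge0 // => i _; rewrite invr_ge0 ltW.
have [|x] := @IVT R f 0 M pi M0 (continuous_subspaceT cf).
  by rewrite f0 ge_min pi_ge0 le_max fM orbT.
rewrite in_itv /= => /andP[x0 _] fx.
have {}x0 : 0 < x.
  rewrite lt_neqAle x0 andbT; apply: contra_eqN fx => /eqP <-.
  by rewrite f0 lt_eqF ?pi_gt0.
exists x^-1; exists (fun i => atan (x * t i)); first by rewrite invr_gt0.
move=> i; have u0 : 0 < atan (x * t i) by rewrite -(@atan0 R) lt_atan // mulr_gt0.
split; first by rewrite u0 atan_ltpi2.
have c0 : cos (atan (x * t i)) != 0.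
  by rewrite gt_eqF // cos_gt0_pihalf // atan_gtNpi2 atan_ltpi2.
have := @atanK R (x * t i); rewrite /tan => xt.
have -> : sin (atan (x * t i)) = x * t i * cos (atan (x * t i)).
  exact: (canRL (divfK c0) xt).
by rewrite !mulrA mulVf ?gt_eqF // mul1r.
Qed.

(* With u i half the angle between the contact points next to vertex i, the
   contact point of side j is at angle arc u j.+1. *)
Definition arc (R : realType) n (u : 'I_n -> R) (k : nat) : R :=
  \sum_(i < n | (i < k)%N) u i *+ 2.

Lemma arc0 (R : realType) n (u : 'I_n -> R) : arc u 0 = 0.
Proof. exact: big_pred0. Qed.

Lemma arc_full (R : realType) n (u : 'I_n -> R) : arc u n = (\sum_i u i) *+ 2.
Proof. by rewrite /arc -sumrMnl; apply: eq_bigl => i; rewrite ltn_ord. Qed.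

Lemma arcS (R : realType) n (u : 'I_n -> R) (j : 'I_n) :
  arc u j.+1 = arc u j + u j *+ 2.
Proof.
rewrite /arc (bigD1 j) //= addrC; congr (_ + _); apply: eq_bigl => i.
by rewrite ltnS [RHS]ltn_neqAle andbC.
Qed.

Lemma arc_lt (R : realType) n (u : 'I_n -> R) k l :
  (forall i, 0 < u i) -> (k < l <= n)%N -> arc u k < arc u l.
Proof.
move=> u0; elim: l => // l IHl; rewrite ltnS => /andP[kl ln].
have -> : arc u l.+1 = _ := arcS u (Ordinal ln).
apply: (@le_lt_trans _ _ (arc u l)); last by rewrite ltrDl mulrn_wgt0.
by case: ltngtP kl => // [kl|->] _; rewrite ?lexx // ltW // IHl // kl ltnW.
Qed.

Lemma arc_cover (R : realType) n (u : 'I_n -> R) x k :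
  0 <= x -> (k <= n)%N -> (0 < k)%N -> x <= arc u k ->
  exists j : 'I_n, arc u j <= x <= arc u j.+1.
Proof.
move=> x0; elim: k => // k IHk kn _ xk.
have [xk'|/ltW kx] := leP x (arc u k); last by exists (Ordinal kn); rewrite kx xk.
case: (posnP k) => [k0|k0]; last exact: IHk (ltnW kn) k0 xk'.
by exists (Ordinal kn); rewrite xk andbT /= k0 arc0.
Qed.

(** Only the last side matters: there the successor's angle restarts at 0 instead of reaching
    $2\pi$. *)
Lemma on_tangent_arc_ordS (R : realType) n (u : 'I_n -> R) (j : 'I_n) (r t : R) :
  \sum_i u i = pi ->
  on_tangent r (arc u (ordS j)) t = on_tangent r (arc u j.+1) t.
Proof.
move=> upi; have [jn|jn] : (j.+1 = n \/ j.+1 < n)%N by have := ltn_ord j; lia.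
  rewrite /= jn modnn arc0 arc_full upi.
  by apply: row2P; rewrite !mxE /= cos0 sin0 cos2pi sin2pi.
by rewrite /= modn_small.
Qed.

Lemma tangent_circumscribed (R : realType) n (t : 'I_n -> R) :
  (4 <= n)%N -> (forall j, 0 < t j) ->
  exists (P : 'I_n -> 'rV[R]_2) (c : 'rV[R]_2) (r : R),
    [/\ convex_polygon P, 0 < r, circumscribed P c r
      & forall j : 'I_n, edist (P j) (P (ordS j)) = t j + t (ordS j)].
Proof.
move=> n4 t0; have [r [u [r0 upi] uP]] := exists_half_angles n4 t0.
have u0 i : 0 < u i by have [/andP[]] := uP i.
have up i : u i < pi / 2 by have [/andP[]] := uP i.
have cu i : 0 < cos (u i) by apply: cos_gt0_pihalf; have := u0 i; have := up i; lra.
have corner (i : 'I_n) := corner_on_tangent (arc u i + u i) (lt0r_neq0 (cu i)) (uP i).2.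
(* Each vertex lies on the bisector of its two contact angles, where the tangents meet. *)
pose P (i : 'I_n) := polar (r / cos (u i)) (arc u i + u i).
have Pl j : P j = on_tangent r (arc u j.+1) (- t j).
  by rewrite /P (corner j).1 arcS mulr2n addrA.
have Pr j : P (ordS j) = on_tangent r (arc u j.+1) (t (ordS j)).
  by rewrite /P (corner (ordS j)).2 addrK on_tangent_arc_ordS.
have arc2pi : arc u n = pi *+ 2 by rewrite arc_full upi.
have arc_ge0 k : (k <= n)%N -> 0 <= arc u k.
  case: (posnP k) => [->|k0 kn]; first by rewrite arc0.
  by rewrite -(arc0 u) ltW // arc_lt // k0.
exists P, 0, r; split=> // [|| j]; last first.
- by rewrite Pl Pr on_tangent_edist // ltW // addr_gt0.
- split=> [X|j]; last by rewrite Pl Pr; exact: on_tangent_side.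
  have contact (j : 'I_n) : convex_hull P (polar r (arc u j.+1)).
    apply: (@segment_convex_hull _ _ _ j (ordS j)); rewrite Pl Pr.
    exact: on_tangent_segment.
  move=> /circleP - /(_ r0); rewrite sqdist0 => Xr.
  have rn0 : r != 0 by rewrite gt_eqF.
  have [|x /andP[x0 x2pi] [X0 X1]] :=
      @unit_vector_angle _ (X 0 0 / r) (X 0 1 / r).
    by rewrite !expr_div_n -mulrDl Xr divff // sqrf_eq0.
  have -> : X = polar r x.
    apply: row2P; rewrite ?polarE0 ?polarE1 -?X0 -?X1; by rewrite mulrC divfK.
  have [j /andP[jx xj]] : exists j : 'I_n, arc u j <= x <= arc u j.+1.
    by apply: (arc_cover x0 (leqnn n)); [lia | rewrite arc2pi].
  (* The arc containing [x] is centred at the angle of vertex [j] and has half-width [u j]. *)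
  have [|p [p0 p1 p2 p3]] :=
      @arc_corner_comb _ r (u j) (x - (arc u j + u j)) (arc u j + u j) (uP j).1.
    by move: xj; rewrite arcS => xj; apply/andP; split; lra.
  rewrite addrC subrK => ->; apply: convex_hull_comb3 => //.
  + by rewrite -addrA -mulr2n -arcS.
  (* This contact point belongs to the preceding side; seeing it as a point of [on_tangent] covers
     the passage from $2\pi$ to 0. *)
  + rewrite addrK -(ord_predK j).
    have polar_on y : polar r y = on_tangent r y 0.
      by apply: row2P; rewrite !mxE /= mul0r ?subr0 ?addr0.
    by rewrite polar_on on_tangent_arc_ordS // -polar_on.
  + exact: convex_hull_vertex.
- split=> [|j k l kj kj' lj lj']; first exact: ltnW.
  suff pos i : i != j -> i != ordS j -> 0 < orient (P j) (P (ordS j)) (P i).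
    by rewrite mulr_gt0 ?pos.
  move=> {k l kj kj' lj lj'} ij ij'.
  rewrite Pl Pr on_tangent_orient; apply: mulr_gt0; first exact: addr_gt0.
  rewrite subr_gt0 polarE0 polarE1 -!mulrA -!mulrDr -cosB -[ltRHS]mulr1 ltr_pM2l //.
  rewrite mulrC ltr_pdivrMr // mul1r.
  (* What remains is that the cosine of the angle between vertex [i] and the contact point of side
     [j] is less than [cos (u i)]. *)
  have Si := arcS u i; have Sj := arcS u j; rewrite mulr2n in Si Sj.
  have ltin := ltn_ord i; have ltjn := ltn_ord j.
  have hi0 := arc_ge0 i (ltnW ltin); have hj0 := arc_ge0 j (ltnW ltjn).
  have ui := u0 i; have uj := u0 j.
  have [lt_ij|lt_ji|/val_inj eq_ij] := ltngtP i j.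
  + rewrite -cosN; apply: ltr_cos_arc; first exact: ltW.
    have := @arc_lt _ _ u i.+1 j.+1 u0; rewrite ltnS lt_ij ltjn => /(_ isT) h1.
    (* For the last side, [i] is not 0 because vertex 0 is an endpoint of that side. *)
    have h2 : arc u j.+1 - arc u i < pi *+ 2.
      have [jn|jn] : (j.+1 = n \/ j.+1 < n)%N by lia.
        suff : 0 < arc u i by rewrite jn arc2pi; lra.
        rewrite -(arc0 u) arc_lt // (ltnW ltin) andbT lt0n.
        by apply: contra ij' => i0; rewrite -val_eqE /= jn modnn.
      have := @arc_lt _ _ u j.+1 n u0; rewrite jn leqnn => /(_ isT).
      by rewrite arc2pi; lra.
    by apply/andP; split; lra.
  + have jS : (j.+1 < i)%N.
      rewrite ltn_neqAle lt_ji andbT; apply: contra ij' => /eqP jS.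
      by rewrite -val_eqE /= jS modn_small.
    apply: ltr_cos_arc; first exact: ltW.
    have := @arc_lt _ _ u j.+1 i u0; rewrite jS (ltnW ltin) => /(_ isT) h1.
    have h2 : arc u i.+1 <= pi *+ 2.
      rewrite -arc2pi; have [->//|ni] : (i.+1 = n \/ i.+1 < n)%N by lia.
      by rewrite ltW // arc_lt // ni leqnn.
    by apply/andP; split; lra.
  + by rewrite eq_ij eqxx in ij.
Qed.

(* MathComp world. The index j in {1, ..., n} is the ordinal of value j - 1 in
   'I_n, so an odd index is an ordinal with an even value. *)
Theorem mainTheorem2 (R : realType) (n : nat) (hn : (4 <= n)%N)
    (hev : ~~ odd n) (a : 'I_n -> R) (ha : forall j, 0 < a j) :
  [<-> (exists (P : 'I_n -> 'rV[R]_2) (c : 'rV[R]_2) (r : R),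
          [/\ convex_polygon P, 0 < r, circumscribed P c r
            & forall j : 'I_n, edist (P j) (P (ordS j)) = a j]);
       (exists t : 'I_n -> R,
          (forall j : 'I_n, 0 < t j)
          /\ (forall j : 'I_n, a j = t j + t (ordS j)));
       (alt_prefix a n = 0
        /\ \big[Num.min/alt_prefix a 1]_(1 <= k < n | odd k) alt_prefix a k
           > \big[Num.max/0]_(1 <= k < n | ~~ odd k) alt_prefix a k);
       (alt_prefix a n = 0
        /\ forall (j : 'I_n) (l : nat),
             odd l -> (1 <= l <= n - 1)%N -> 0 < alt_cyclic a j l);
       (alt_prefix a n = 0
        /\ forall (j : 'I_n) (l : nat),
             ~~ odd j -> odd l -> (1 <= l <= n - 1)%N ->
             0 < alt_cyclic a j l)].
Proof.
have n2 : (2 <= n)%N by apply: leq_trans hn.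
have n0 : (0 < n)%N by apply: leq_trans hn.
tfae.
- move=> [P [c [r [cvx r0 circ len]]]]; exact: circumscribed_tangent cvx r0 circ len.
- move=> [t [t0 at_]]; split; first exact: tangent_alt_prefix0 at_.
  exact: tangent_alt_prefix_sep at_.
- move=> [an0 /(alt_prefix_sep_tangent n0 hev an0)[t [t0 at_]]]; split=> // j l ol _.
  exact: tangent_alt_cyclic_gt0 at_ ol.
- by move=> [an0 pos]; split=> // j l _; exact: pos.
(* The cycle closes through (iii) and (ii). *)
- move=> [an0 /(alt_cyclic_even_sep n2 hev an0)].
  move=> /(alt_prefix_sep_tangent n0 hev an0)[t [t0 at_]].
  have [P [c [r [cvx r0 circ len]]]] := tangent_circumscribed hn t0.
  by exists P, c, r; split=> // j; rewrite len at_.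
Qed.
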